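(* Let $f,g_i,h_j,G_l,H_l\colon\mathbb{R}^n\to\mathbb{R}$ ($i\in\mathcal M$, $j\in\mathcal P$, $l\in\mathcal Q$) be continuously differentiable, and consider the switching-constrained problem (MPSC) with feasible set $X$ and the relaxed problems $(\mathrm{P}(t))$ with feasible sets $X(t)$, as defined in the context. Let $\{t_k\}_{k\in\mathbb{N}}\subset(0,\infty)$ be a sequence converging to $0$. For each $k\in\mathbb{N}$, let $x_k\in X(t_k)$ be a KKT point of $(\mathrm{P}(t_k))$, and assume that $\{x_k\}_{k\in\mathbb{N}}$ converges to some $\bar x\in\mathbb{R}^n$ (it then holds that $\bar x\in X$). Suppose that MPSC-NNAMCQ holds at $\bar x$. Then $\bar x$ is an M-stationary point of (MPSC).
   Context: Index sets: $\mathcal M=\{1,\dots,m\}$, $\mathcal P=\{1,\dots,p\}$, $\mathcal Q=\{1,\dots,q\}$, $\mathcal S=\{1,2,3,4\}$. (MPSC) is the problem: minimize $f(x)$ over $x\in\mathbb{R}^n$ subject to $g_i(x)\le 0$ ($i\in\mathcal M$), $h_j(x)=0$ ($j\in\mathcal P$), $G_l(x)H_l(x)=0$ ($l\in\mathcal Q$). Its feasible set is $X$. For $\bar x\in X$ put $I^g(\bar x)=\{i\in\mathcal M: g_i(\bar x)=0\}$, $I^G(\bar x)=\{l\in\mathcal Q: G_l(\bar x)=0,\ H_l(\bar x)\ne0\}$, $I^H(\bar x)=\{l\in\mathcal Q: G_l(\bar x)\neq0,\ H_l(\bar x)=0\}$, $I^{GH}(\bar x)=\{l\in\mathcal Q: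 G_l(\bar x)=0,\ H_l(\bar x)=0\}$. Relaxation: define the continuously differentiable function $\varphi\colon\mathbb{R}^2\to\mathbb{R}$ by $\varphi(a,b)=ab$ if $a+b\ge0$ and $\varphi(a,b)=-\tfrac12(a^2+b^2)$ if $a+b<0$. For $t\ge0$, $l\in\mathcal Q$, $x\in\mathbb{R}^n$ set $\Phi^1_l(x;t)=\varphi(G_l(x)-t,H_l(x)-t)$, $\Phi^2_l(x;t)=\varphi(-G_l(x)-t,H_l(x)-t)$, $\Phi^3_l(x;t)=\varphi(-G_l(x)-t,-H_l(x)-t)$, $\Phi^4_l(x;t)=\varphi(G_l(x)-t,-H_l(x)-t)$. $(\mathrm{P}(t))$ is the nonlinear program: minimize $f(x)$ subject to $g_i(x)\le0$ ($i\in\mathcal M$), $h_j(x)=0$ ($j\in\mathcal P$), $\Phi^s_l(x;t)\le0$ ($s\in\mathcal S$, $l\in\mathcal Q$). Its feasible set is $X(t)$. KKT point: a feasible point of a nonlinear program with inequality constraints $c_i\le0$ and equality constraints $e_j=0$ at which there are multipliers $\lambda_i\ge0$ for the active inequality constraints and real multipliers $\rho_j$ for the equality constraints such that $\nabla f+\sum_{i\text{ active}}\lambda_i\nabla c_i+\sum_j\rho_j\nabla e_j=0$ at that point. M-stationarity: $\bar x\in X$ is M-stationary for (MPSC) if there are real multipliers $\lambda_i$ ($i\in I^g(\bar x)$), $\rho_j$ ($j\in\mathcal P$), $\mu_l,\nu_l$ ($l\in\mathcal Q$) with $0=\nabla f(\bar x)+\sum_{i\in I^g(\bar x)}\lambda_i\nabla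 g_i(\bar x)+\sum_{j\in\mathcal P}\rho_j\nabla h_j(\bar x)+\sum_{l\in\mathcal Q}[\mu_l\nabla G_l(\bar x)+\nu_l\nabla H_l(\bar x)]$, $\lambda_i\ge0$ for $i\in I^g(\bar x)$, $\mu_l=0$ for $l\in I^H(\bar x)$, $\nu_l=0$ for $l\in I^G(\bar x)$, and $\mu_l\nu_l=0$ for $l\in I^{GH}(\bar x)$. MPSC-NNAMCQ holds at $\bar x\in X$ if the only multipliers $\lambda_i$ ($i\in I^g(\bar x)$), $\rho_j$ ($j\in\mathcal P$), $\mu_l,\nu_l$ ($l\in\mathcal Q$) satisfying $0=\sum_{i\in I^g(\bar x)}\lambda_i\nabla g_i(\bar x)+\sum_{j\in\mathcal P}\rho_j\nabla h_j(\bar x)+\sum_{l\in\mathcal Q}[\mu_l\nabla G_l(\bar x)+\nu_l\nabla H_l(\bar x)]$, $\lambda_i\ge0$ for $i\in I^g(\bar x)$, $\mu_l=0$ for $l\in I^H(\bar x)$, $\nu_l=0$ for $l\in I^G(\bar x)$, and $\mu_l\nu_l=0$ for $l\in I^{GH}(\bar x)$ are $\lambda=0$, $\rho=0$, $\mu=0$, $\nu=0$. *)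

(* Defs.v *)
From mathcomp Require Import all_boot all_order all_algebra.
From mathcomp Require Import boolp classical_sets reals topology normedtype.
From mathcomp Require Import sequences derive.

Set Implicit Arguments.
Unset Strict Implicit.
Unset Printing Implicit Defensive.

Import Order.TTheory GRing.Theory Num.Theory.
Import numFieldNormedType.Exports.

Local Open Scope ring_scope.

Definition grad (R : realType) (n : nat) (f : 'rV[R]_n -> R) (x : 'rV[R]_n) :
  'rV[R]_n := \row_j 'D_(delta_mx 0 j) f x.

Definition continuously_differentiable (R : realType) (n : nat)
    (f : 'rV[R]_n -> R) : Prop :=
  (forall x, differentiable f x) /\ continuous (grad f).

Record nlp (R : realType) (n : nat) (I J : finType) := NLP {
  nlp_obj : 'rV[R]_n -> R;
  nlp_ineq : I -> 'rV[R]_n -> R;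
  nlp_eq : J -> 'rV[R]_n -> R }.

Definition nlp_feasible (R : realType) (n : nat) (I J : finType)
    (N : nlp R n I J) : set 'rV[R]_n :=
  [set x | (forall i, nlp_ineq N i x <= 0) /\
           (forall j, nlp_eq N j x = 0)]%classic.

Definition KKT_point (R : realType) (n : nat) (I J : finType)
    (N : nlp R n I J) (x : 'rV[R]_n) : Prop :=
  nlp_feasible N x /\
  exists (lambda : I -> R) (rho : J -> R),
    (forall i, nlp_ineq N i x = 0 -> 0 <= lambda i) /\
    grad (nlp_obj N) x
      + \sum_(i | nlp_ineq N i x == 0) lambda i *: grad (nlp_ineq N i) x
      + \sum_j rho j *: grad (nlp_eq N j) x = 0.

Record mpsc (R : realType) (n m p q : nat) := MPSC {
  obj : 'rV[R]_n -> R;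
  ineq : 'I_m -> 'rV[R]_n -> R;
  equ : 'I_p -> 'rV[R]_n -> R;
  swG : 'I_q -> 'rV[R]_n -> R;
  swH : 'I_q -> 'rV[R]_n -> R }.

Section MPSC.
Context (R : realType) (n m p q : nat) (P : mpsc R n m p q).
Implicit Types (x : 'rV[R]_n) (t : R).

Definition feasible : set 'rV[R]_n :=
  [set x | [/\ forall i, ineq P i x <= 0,
               forall j, equ P j x = 0 &
               forall l, swG P l x * swH P l x = 0]]%classic.

Definition Ig x : {set 'I_m} := [set i | ineq P i x == 0]%SET.
Definition IG x : {set 'I_q} :=
  [set l | (swG P l x == 0) && (swH P l x != 0)]%SET.
Definition IH x : {set 'I_q} :=
  [set l | (swG P l x != 0) && (swH P l x == 0)]%SET.
Definition IGH x : {set 'I_q} :=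
  [set l | (swG P l x == 0) && (swH P l x == 0)]%SET.

Definition phi (a b : R) : R :=
  if 0 <= a + b then a * b else - (2^-1 * (a ^+ 2 + b ^+ 2)).

(* The index s : 'I_4 is shifted by one: values 0, 1, 2, 3 stand for the
   superscripts 1, 2, 3, 4. *)
Definition Phi (s : 'I_4) (l : 'I_q) t x : R :=
  match val s with
  | 0%N => phi (swG P l x - t) (swH P l x - t)
  | 1%N => phi (- swG P l x - t) (swH P l x - t)
  | 2%N => phi (- swG P l x - t) (- swH P l x - t)
  | _ => phi (swG P l x - t) (- swH P l x - t)
  end.

Definition relaxed_ineq t (c : 'I_m + 'I_4 * 'I_q) : 'rV[R]_n -> R :=
  match c with
  | inl i => ineq P i
  | inr (s, l) => Phi s l t
  end.

Definition relaxation t : nlp R n ('I_m + 'I_4 * 'I_q)%type 'I_p :=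
  NLP (obj P) (relaxed_ineq t) (equ P).

(* lambda is only constrained, and only used, on the active set Ig x; its
   values elsewhere are irrelevant. *)
Definition M_multipliers x (lambda : 'I_m -> R) (mu nu : 'I_q -> R) : Prop :=
  [/\ forall i, i \in Ig x -> 0 <= lambda i,
      forall l, l \in IH x -> mu l = 0,
      forall l, l \in IG x -> nu l = 0 &
      forall l, l \in IGH x -> mu l * nu l = 0].

Definition constraint_combination x (lambda : 'I_m -> R) (rho : 'I_p -> R)
    (mu nu : 'I_q -> R) : 'rV[R]_n :=
  \sum_(i in Ig x) lambda i *: grad (ineq P i) x
  + \sum_j rho j *: grad (equ P j) x
  + \sum_l (mu l *: grad (swG P l) x + nu l *: grad (swH P l) x).

Definition M_stationary x : Prop :=
  feasible x /\
  exists (lambda : 'I_m -> R) (rho : 'I_p -> R) (mu nu : 'I_q -> R),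
    0 = grad (obj P) x + constraint_combination x lambda rho mu nu /\
    M_multipliers x lambda mu nu.

Definition MPSC_NNAMCQ x : Prop :=
  forall (lambda : 'I_m -> R) (rho : 'I_p -> R) (mu nu : 'I_q -> R),
    0 = constraint_combination x lambda rho mu nu ->
    M_multipliers x lambda mu nu ->
    [/\ forall i, i \in Ig x -> lambda i = 0,
        forall j, rho j = 0,
        forall l, mu l = 0 &
        forall l, nu l = 0].

End MPSC.

(* Main.v *)
Require Import Defs.
From mathcomp Require Import all_boot all_order all_algebra.
From mathcomp Require Import boolp classical_sets reals topology normedtype.
From mathcomp Require Import sequences derive.
From mathcomp Require Import ring lra.
Import Order.TTheory GRing.Theory Num.Theory.
Import numFieldNormedType.Exports.
Set Implicit Arguments.
Unset Strict Implicit.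
Unset Printing Implicit Defensive.
Local Open Scope ring_scope.
Local Open Scope classical_set_scope.

(** Normalised multipliers of the relaxed problems have a limit, and in that
    limit they become M-multipliers.

    - Active constraints.  The function phi vanishes at (a, b) exactly when
      a, b >= 0 and a b = 0, and its gradient there is (b, a)
      ([phi_eq0], [grad_phi]).  The four functions Phi of one index l apply phi
      to (+-G_l - t, +-H_l - t), so for t > 0 an active one forces the signs of
      G_l and H_l, hence is the only active one for this l ([Phi_active],
      [quadrant_inj]).  Its gradient is, up to signs,
      (|H_l| - t) grad G_l + (|G_l| - t) grad H_l, with at most one nonzero
      coefficient.

    - Hence the relaxed KKT multipliers yield mu_l, nu_l with
      mu_l (|G_l| - t) = 0, nu_l (|H_l| - t) = 0 and mu_l nu_l = 0
      ([KKT_fritz_john]).  Together with complementarity for g this is a system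
      [fritz_john] of equations and weak inequalities, homogeneous in the
      multipliers and closed under limits in t, x and the multipliers
      ([fritz_john_scale], [fritz_john_cvg]).  For t = 0 it says that the
      multipliers are M-multipliers with an extra weight alpha >= 0 on grad f
      ([fritz_john_M_multipliers]).

    - Scale the multipliers at x_k, which have weight 1 on grad f, to unit
      l1-norm and pass to the limit along an ultrafilter refining the
      filter of cofinite sets; this plays the part of a convergent subsequence
      ([cvg_direction_ultra]).  The limit multipliers are not all zero.  If
      alpha were 0, they would contradict MPSC-NNAMCQ; so alpha > 0, and
      dividing by alpha gives M-stationarity ([fritz_john_M_stationary]).  This
      treats bounded and unbounded multiplier sequences at once. *)

(** * The function phi *)

(** In this form the only piecewise term is the square of a negative part,
    which is flat wherever a + b >= 0. *)
Lemma phiE (R : realType) (a b : R) :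
  phi a b = a * b - 2^-1 * Num.min (a + b) 0 ^+ 2.
Proof.
rewrite /phi; case: (lerP 0 (a + b)) => ab.
- by rewrite expr0n mulr0 subr0.
- by field.
Qed.

Lemma phi_gt0 (R : realType) (a b : R) : 0 < a -> 0 < b -> 0 < phi a b.
Proof. by move=> a0 b0; rewrite /phi ltW ?addr_gt0 // mulr_gt0. Qed.

Lemma phi_eq0 (R : realType) (a b : R) :
  phi a b = 0 -> [/\ 0 <= a, 0 <= b & a * b = 0].
Proof.
rewrite /phi; case: (lerP 0 (a + b)) => ab.
  move=> /eqP; rewrite mulf_eq0 => /orP[] /eqP ab0.
  - by move: ab; rewrite ab0 add0r mul0r; split.
  - by move: ab; rewrite ab0 addr0 mulr0; split.
have := sqr_ge0 (a - b).
have : 0 < (a + b) ^+ 2 by rewrite exprn_even_gt0 //= lt_eqF.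
rewrite sqrrD sqrrB => pos nneg eq0; exfalso; lra.
Qed.

(** As [u x >= 0], the negative part of [u] at a nearby point is at most the
    increment of [u]; so its square is of second order along [d]. *)
Lemma is_derive_sqr_min0 (R : realType) (V : normedModType R) (u : V -> R)
    (x d : V) :
  derivable u x d -> 0 <= u x ->
  is_derive x d (fun y => Num.min (u y) 0 ^+ 2) 0.
Proof.
move=> du ux0.
have cvg0 : h^-1 *: (((fun y => Num.min (u y) 0 ^+ 2) \o shift x) (h *: d)
    - Num.min (u x) 0 ^+ 2) @[h --> 0^'] --> (0 : R).
  (* r h is the difference quotient of u, and |h| (r h)^2 dominates that of
     the squared negative part. *)
  pose r (h : R) := h^-1 *: ((u \o shift x) (h *: d) - u x).
  apply/norm_cvg0P.
  have bnd : `|h| * r h ^+ 2 @[h --> 0^'] --> (0 : R).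
    have cvgh : h @[h --> (0 : R)^'] --> (0 : R) by exact: nbhs_dnbhs.
    have := cvgM (cvg_norm cvgh) (cvgM du du).
    rewrite normr0 mul0r; exact.
  apply: (squeeze_cvgr _ (cvg_cst 0) bnd).
  near=> h; rewrite normr_ge0 /=.
  have h0 : h != 0 by near: h; exact: nbhs_dnbhs_neq.
  rewrite (min_r ux0) expr0n subr0.
  have -> : `|h| * r h ^+ 2 = `|h|^-1 * (u (h *: d + x) - u x) ^+ 2.
    rewrite /r exprMn exprVn -[h ^+ 2](@real_normK _ h) ?num_real //=.
    by field; rewrite normr_eq0.
  rewrite normrM normfV ler_wpM2l ?invr_ge0 //= normrX.
  rewrite -[leRHS]ger0_norm ?sqr_ge0 //.
  rewrite normrX ler_sqr ?nnegrE //.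
  by case: (leP (u (h *: d + x)) 0) => uh;
    rewrite ?normr0 // ?(ler0_norm uh) ler0_norm; lra.
by split; [exact: (cvgP _ cvg0)|exact: (cvg_lim _ cvg0)].
Unshelve. all: by end_near. Qed.

Lemma is_derive_phi (R : realType) (V : normedModType R) (u v : V -> R)
    (x d : V) (du dv : R) :
  is_derive x d u du -> is_derive x d v dv -> 0 <= u x + v x ->
  is_derive x d (fun y => phi (u y) (v y)) (v x * du + u x * dv).
Proof.
move=> hu hv uv0.
have hmin : is_derive x d (fun y => Num.min (u y + v y) 0 ^+ 2) 0.
  by apply: is_derive_sqr_min0 => //; apply: (derivableD (f := u) (g := v)).
have := is_deriveB (is_deriveM hu hv) (is_deriveZ 2^-1 hmin).
rewrite scaler0 subr0 => hphi.
have := is_derive_eq hphi (addrC _ _); congr (is_derive _ _ _ _).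
by apply/funext => y; rewrite phiE.
Qed.

Lemma grad_phi (R : realType) (n : nat) (u v : 'rV[R]_n -> R)
    (x : 'rV[R]_n) (a b c : R) :
  differentiable u x -> differentiable v x ->
  0 <= (a * u x - c) + (b * v x - c) ->
  grad (fun y => phi (a * u y - c) (b * v y - c)) x =
  ((b * v x - c) * a) *: grad u x + ((a * u x - c) * b) *: grad v x.
Proof.
move=> du dv ge0; apply/rowP => j; rewrite !mxE.
have affine (w : 'rV[R]_n -> R) e : differentiable w x ->
    is_derive x (delta_mx 0 j) (fun y => e * w y - c)
      (e * 'D_(delta_mx 0 j) w x).
  move=> dw; have wx := derivableP (diff_derivable (v := delta_mx 0 j) dw).
  have := is_deriveB (is_deriveZ e wx) (is_derive_cst c x (delta_mx 0 j)).
  by rewrite subr0.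
have uv := is_derive_phi (affine u a du) (affine v b dv) ge0.
by rewrite (derive_val (is_derive := uv)) !mulrA.
Qed.

(** * Limits of normalised families *)

Lemma bounded_cvg_ultra (R : realType) (T : Type) (U : set_system T)
    (u : T -> R) (M : R) :
  UltraFilter U -> (forall k, `|u k| <= M) -> exists l : R, u k @[k --> U] --> l.
Proof.
move=> UU uM.
have uMM : fmap u U `[- M, M]%classic.
  by apply: (@filterE _ U) => k; rewrite /= in_itv /= -ler_norml.
have [l [_ lU]] := @segment_compact R (- M) M (fmap u U) _ uMM.
exists l => V Vl.
case: (in_ultra_setVsetC (u @^-1` V) UU) => // nV.
by have [y [] ] := lU (~` V) V nV Vl.
Qed.

(** Compactness of the l1-unit sphere: nonzero vectors can be rescaled so as to
    have a nonzero limit along an ultrafilter. *)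
Lemma cvg_direction_ultra (R : realType) (T : Type) (J : finType)
    (U : set_system T) (w : T -> J -> R) :
  UltraFilter U -> (forall k, exists j, w k j != 0) ->
  exists (c : T -> R) (l : J -> R),
    [/\ forall k, 0 < c k, forall j, c k * w k j @[k --> U] --> l j &
        exists j, l j != 0].
Proof.
move=> UU w0; pose s k := \sum_j `|w k j|.
have s_gt0 k : 0 < s k.
  have [j wj0] := w0 k; rewrite /s (bigD1 j) //= ltr_pwDl ?normr_gt0 //.
  exact: sumr_ge0.
have sw1 k : \sum_j `|(s k)^-1 * w k j| = 1.
  under eq_bigr do rewrite normrM normfV (gtr0_norm (s_gt0 k)).
  by rewrite -mulr_sumr mulVf // gt_eqF.
have /choice[l cvgl] : forall j, exists a : R, (s k)^-1 * w k j @[k --> U] --> a.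
  move=> j; apply: (@bounded_cvg_ultra _ _ _ _ 1) => k; rewrite -(sw1 k).
  by rewrite (bigD1 j) //= lerDl sumr_ge0.
exists (fun k => (s k)^-1), l; split => // [k|]; first by rewrite invr_gt0.
apply: contrapT => /forallNP l0.
have : \sum_j `|(s k)^-1 * w k j| @[k --> U] --> \sum_j `|l j|.
  by apply: cvg_big => [|j _]; [exact: add_continuous|exact: cvg_norm].
under eq_fun do rewrite sw1.
move/(cvg_unique (@Rhausdorff R) (cvg_cst _)) => /eqP.
rewrite big1 ?oner_eq0 // => j _.
by have /negP := l0 j; rewrite negbK => /eqP ->; rewrite normr0.
Qed.
(** * The relaxed switching constraints *)

(** [negG s] and [negH s] tell whether the constraint [Phi s] takes G, resp. H,
    with a minus sign. *)
Definition negG (s : 'I_4) : bool := (val s == 1)%N || (val s == 2)%N.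
Definition negH (s : 'I_4) : bool := (2 <= val s)%N.

Lemma quadrantP (a b : bool) : exists s, negG s = a /\ negH s = b.
Proof.
have sgn k (k4 : (k < 4)%N) : exists s : 'I_4, negG s = (k == 1)%N || (k == 2)%N
    /\ negH s = (2 <= k)%N by exists (Ordinal k4).
case: a; case: b; [exact: (sgn 2%N)|exact: (sgn 1%N)|exact: (sgn 3%N)
  |exact: (sgn 0%N)].
Qed.

Lemma quadrant_inj (s s' : 'I_4) :
  negG s = negG s' -> negH s = negH s' -> s = s'.
Proof.
case: s => k k4; case: s' => k' k'4; rewrite /negG /negH /= => eG eH.
by apply: val_inj => /=;
  move: k k4 k' k'4 eG eH => [|[|[|[|k]]]] ? [|[|[|[|k']]]].
Qed.

Lemma PhiE (R : realType) (n m p q : nat) (P : mpsc R n m p q) s l t :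
  Phi P s l t = (fun x => phi ((-1) ^+ negG s * swG P l x - t)
                              ((-1) ^+ negH s * swH P l x - t)).
Proof.
apply/funext => x; rewrite /Phi /negG /negH.
by case: s => -[|[|[|[|k]]]] k4 //=; rewrite ?expr0 ?expr1 ?mul1r ?mulN1r.
Qed.

Lemma signed_ge_gt0 (R : realDomainType) (b : bool) (a t : R) : 0 < t ->
  t <= (-1) ^+ b * a -> b = (a < 0) /\ (-1) ^+ b * a = `|a|.
Proof.
case: b => t0; rewrite ?expr0 ?expr1 ?mul1r ?mulN1r => ta.
  have a0 : a < 0 by rewrite -oppr_gt0; exact: lt_le_trans ta.
  by rewrite a0 ltr0_norm.
have a0 : 0 < a by exact: lt_le_trans ta.
by rewrite gtr0_norm // ltNge ltW.
Qed.

(** Since t > 0, G and H are nonzero at an active constraint, and their signs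
    are those that [s] prescribes: by [quadrant_inj] they determine [s]. *)
Lemma Phi_active (R : realType) (n m p q : nat) (P : mpsc R n m p q) s l t x :
  0 < t -> Phi P s l t x = 0 ->
  [/\ negG s = (swG P l x < 0), negH s = (swH P l x < 0),
      (-1) ^+ negG s * swG P l x = `|swG P l x|,
      (-1) ^+ negH s * swH P l x = `|swH P l x| &
      (`|swG P l x| - t) * (`|swH P l x| - t) = 0].
Proof.
move=> t0; rewrite PhiE => /phi_eq0[]; rewrite !subr_ge0 => tG tH GH0.
have [sG eG] := signed_ge_gt0 t0 tG; have [sH eH] := signed_ge_gt0 t0 tH.
by split=> //; rewrite -eG -eH.
Qed.

Lemma grad_Phi_active (R : realType) (n m p q : nat) (P : mpsc R n m p q)
    s l t x :
  differentiable (swG P l) x -> differentiable (swH P l) x ->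
  Phi P s l t x = 0 ->
  grad (Phi P s l t) x =
  (((-1) ^+ negH s * swH P l x - t) * (-1) ^+ negG s) *: grad (swG P l) x +
  (((-1) ^+ negG s * swG P l x - t) * (-1) ^+ negH s) *: grad (swH P l) x.
Proof.
rewrite PhiE => dG dH /phi_eq0[G0 H0 _].
by rewrite grad_phi // addr_ge0.
Qed.

(** The constraint whose quadrant contains (G x, H x) is phi (|G| - t, |H| - t),
    which is positive when |G| and |H| both exceed t. *)
Lemma min_norm_le (R : realType) (n m p q : nat) (P : mpsc R n m p q) t x l :
  (forall s, Phi P s l t x <= 0) ->
  Num.min `|swG P l x| `|swH P l x| <= t.
Proof.
move=> Phi0; have [s [sG sH]] := quadrantP (swG P l x < 0) (swH P l x < 0).
have := Phi0 s; rewrite PhiE sG sH -!normrEsign leNgt ge_min; apply: contraNT.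
by rewrite negb_or -!ltNge => /andP[tG tH]; rewrite phi_gt0 // subr_gt0.
Qed.

(** * Fritz John systems *)

(** [None] carries the weight of the objective; the other indices are those of
    g, h, G and H, in this order. *)
Definition multiplier_index (m p q : nat) : finType :=
  option (('I_m + 'I_p) + ('I_q + 'I_q))%type.

Section FritzJohn.
Context (R : realType) (n m p q : nat) (P : mpsc R n m p q).
Implicit Types (w : multiplier_index m p q -> R) (x : 'rV[R]_n) (t : R).

Notation lam w i := (w (Some (inl (inl i)))).
Notation rho w j := (w (Some (inl (inr j)))).
Notation mu w l := (w (Some (inr (inl l)))).
Notation nu w l := (w (Some (inr (inr l)))).

(** The switching multipliers are constrained by products instead of by cases on
    active indices: products pass to the limit as they stand, and with t = 0
    they give back the conditions on the index sets of G and H. *)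
Definition fritz_john t x w : Prop :=
  [/\ w None *: grad (obj P) x
        + \sum_i lam w i *: grad (ineq P i) x
        + \sum_j rho w j *: grad (equ P j) x
        + \sum_l (mu w l *: grad (swG P l) x + nu w l *: grad (swH P l) x) = 0,
      0 <= w None,
      forall i, 0 <= lam w i /\ lam w i * ineq P i x = 0 &
      forall l, [/\ mu w l * (`|swG P l x| - t) = 0,
                    nu w l * (`|swH P l x| - t) = 0 & mu w l * nu w l = 0]].

Lemma fritz_john_scale (c t : R) x w :
  0 <= c -> fritz_john t x w -> fritz_john t x (fun j => c * w j).
Proof.
move=> c0 [stat w0 lamP swP]; split.
- apply: (etrans _ (etrans (congr1 (fun v => c *: v) stat) (scaler0 _ _))).
  rewrite /= !scalerDr !scaler_sumr scalerA; congr (_ + _ + _ + _);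
    by apply: eq_bigr => i _; rewrite ?scalerDr !scalerA.
- exact: mulr_ge0.
- move=> i; have [l0 lg] := lamP i; split; first exact: mulr_ge0.
  by rewrite -mulrA lg mulr0.
- move=> l; have [muP nuP munu] := swP l.
  by split; rewrite ?[c * _ * (c * _)]mulrACA ?munu -?mulrA ?muP ?nuP ?mulr0.
Qed.

(** For each l the multipliers of G and H collect the contributions of the four
    constraints [Phi s l]; all three product conditions hold because at most one
    of these constraints is active, and there (|G| - t)(|H| - t) = 0. *)
Lemma KKT_fritz_john t x :
  (forall l, differentiable (swG P l) x) ->
  (forall l, differentiable (swH P l) x) ->
  0 < t -> KKT_point (relaxation P t) x ->
  exists w, w None = 1 /\ fritz_john t x w.
Proof.
move=> dG dH t0 [_ [lambda [rho0 [lambda0 stat]]]].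
pose a l s := if Phi P s l t x == 0 then lambda (inr (s, l)) else 0.
pose mu0 l := \sum_s a l s * ((`|swH P l x| - t) * (-1) ^+ negG s).
pose nu0 l := \sum_s a l s * ((`|swG P l x| - t) * (-1) ^+ negH s).
have act l s : a l s != 0 -> Phi P s l t x = 0.
  by rewrite /a; case: ifP => [/eqP|]; rewrite ?eqxx.
have swE : \sum_(c | relaxed_ineq P t (inr c) x == 0)
      lambda (inr c) *: grad (relaxed_ineq P t (inr c)) x =
    \sum_l (mu0 l *: grad (swG P l) x + nu0 l *: grad (swH P l) x).
  rewrite big_mkcond (eq_bigr (fun c => a c.2 c.1 *: grad (Phi P c.1 c.2 t) x));
    last by move=> [s l] _ /=; rewrite /a; case: ifP; rewrite ?scale0r.
  rewrite -(pair_bigA _ (fun s l => a l s *: grad (Phi P s l t) x)) exchange_big.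
  apply: eq_bigr => l _; rewrite !scaler_suml -big_split; apply: eq_bigr => s _ /=.
  have [->|/act Phi0] := eqVneq (a l s) 0; first by rewrite !mul0r !scale0r addr0.
  have [_ _ eG eH _] := Phi_active t0 Phi0.
  by rewrite grad_Phi_active // eG eH scalerDr !scalerA.
exists (fun c => match c with
  | None => 1
  | Some (inl (inl i)) => if ineq P i x == 0 then lambda (inl i) else 0
  | Some (inl (inr j)) => rho0 j
  | Some (inr (inl l)) => mu0 l
  | Some (inr (inr l)) => nu0 l end); split=> //; split => //=.
- rewrite -[RHS]stat scale1r big_sumType /= swE addrAC [in RHS]addrA.
  congr (_ + _ + _ + _); rewrite [RHS]big_mkcond; apply: eq_bigr => i _.
  by case: ifP; rewrite ?scale0r.
- move=> i; case: eqP => gi; last by rewrite mul0r.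
  by rewrite gi mulr0; split=> //; apply: lambda0.
- move=> l; split.
  + rewrite mulr_suml big1 // => s _.
    have [->|/act/(Phi_active t0)[_ _ _ _ GH0]] := eqVneq (a l s) 0.
      by rewrite !mul0r.
    rewrite [LHS](_ : _ = a l s * (-1) ^+ negG s *
      ((`|swG P l x| - t) * (`|swH P l x| - t))); last ring.
    by rewrite GH0 mulr0.
  + rewrite mulr_suml big1 // => s _.
    have [->|/act/(Phi_active t0)[_ _ _ _ GH0]] := eqVneq (a l s) 0.
      by rewrite !mul0r.
    rewrite [LHS](_ : _ = a l s * (-1) ^+ negH s *
      ((`|swG P l x| - t) * (`|swH P l x| - t))); last ring.
    by rewrite GH0 mulr0.
  (* Only the active index s, if any, survives in both sums. *)
  + case: (pickP (fun s => a l s != 0)) => [s as0|a0]; last first.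
      by rewrite /mu0 big1 ?mul0r // => s _; rewrite (eqP (negbFE (a0 s))) mul0r.
    have [sG sH _ _ GH0] := Phi_active t0 (act _ _ as0).
    have uniq s' : s' != s -> a l s' = 0.
      apply: contraNeq => /act/(Phi_active t0)[sG' sH' _ _ _].
      by apply/eqP; apply: quadrant_inj; rewrite ?sG ?sH.
    rewrite /mu0 /nu0 (bigD1 s) //= big1 => [|s' /uniq ->]; last by rewrite mul0r.
    rewrite (bigD1 s) //= big1 => [|s' /uniq ->]; last by rewrite mul0r.
    rewrite !addr0 [LHS](_ : _ = a l s * (-1) ^+ negH s * a l s * (-1) ^+ negG s *
      ((`|swG P l x| - t) * (`|swH P l x| - t))); last ring.
    by rewrite GH0 mulr0.
Qed.

Lemma fritz_john_cvg (T : Type) (U : set_system T) (t_ : T -> R)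
    (x_ : T -> 'rV[R]_n) (w_ : T -> multiplier_index m p q -> R) t x w :
  ProperFilter U ->
  {for x, continuous (grad (obj P))} ->
  (forall i, {for x, continuous (ineq P i)} /\
             {for x, continuous (grad (ineq P i))}) ->
  (forall j, {for x, continuous (grad (equ P j))}) ->
  (forall l, {for x, continuous (swG P l)} /\
             {for x, continuous (grad (swG P l))}) ->
  (forall l, {for x, continuous (swH P l)} /\
             {for x, continuous (grad (swH P l))}) ->
  t_ k @[k --> U] --> t -> x_ k @[k --> U] --> x ->
  (forall j, w_ k j @[k --> U] --> w j) ->
  (forall k, fritz_john (t_ k) (x_ k) (w_ k)) -> fritz_john t x w.
Proof.
move=> UU cf cg ch cG cH tU xU wU FJ.
have at_x (V : normedModType R) (F : 'rV[R]_n -> V) :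
    {for x, continuous F} -> F (x_ k) @[k --> U] --> F x.
  by move=> cF; apply: continuous_cvg.
have cvg0 (V : normedModType R) (F : T -> V) (a : V) :
    (forall k, F k = 0) -> F k @[k --> U] --> a -> a = 0.
  move=> F0 Fa; apply: (cvg_unique (@norm_hausdorff _ _) Fa).
  by rewrite (_ : (fun k => F k) = fun=> 0); [exact: cvg_cst|exact/funext].
have cvg_ge0 (F : T -> R) (a : R) :
    (forall k, 0 <= F k) -> F k @[k --> U] --> a -> 0 <= a.
  move=> F0 Fa; apply: (closed_cvg _ (@closed_ge R 0) _ _ Fa).
  exact: (@filterE _ U).
have cvg_sum (I : finType) (F : T -> I -> 'rV[R]_n) (a : I -> 'rV[R]_n) :
    (forall i, F k i @[k --> U] --> a i) ->
    \sum_i F k i @[k --> U] --> \sum_i a i.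
  by move=> Fa; apply: cvg_big => //; exact: add_continuous.
split.
- pose L k := w_ k None *: grad (obj P) (x_ k)
    + \sum_i lam (w_ k) i *: grad (ineq P i) (x_ k)
    + \sum_j rho (w_ k) j *: grad (equ P j) (x_ k)
    + \sum_l (mu (w_ k) l *: grad (swG P l) (x_ k)
              + nu (w_ k) l *: grad (swH P l) (x_ k)).
  apply: (cvg0 _ L) => [k|]; first by have [] := FJ k.
  apply: cvgD; [apply: cvgD; [apply: cvgD|]|].
  + by apply: cvgZ => //; exact: at_x.
  + by apply: cvg_sum => i; apply: cvgZ => //; apply: at_x; have [] := cg i.
  + by apply: cvg_sum => j; apply: cvgZ => //; apply: at_x.
  + apply: cvg_sum => l; apply: cvgD; apply: cvgZ => //; apply: at_x.
      by have [] := cG l.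
    by have [] := cH l.
- by apply: (cvg_ge0 (fun k => w_ k None)) => // k; have [] := FJ k.
- move=> i; split.
    by apply: (cvg_ge0 (fun k => lam (w_ k) i)) => // k; have [_ _ /(_ i)[]] := FJ k.
  apply: (cvg0 _ (fun k => lam (w_ k) i * ineq P i (x_ k))) => [k|].
    by have [_ _ /(_ i)[]] := FJ k.
  by apply: cvgM => //; apply: at_x; have [] := cg i.
- have cvg_gap (F : 'rV[R]_n -> R) : {for x, continuous F} ->
      `|F (x_ k)| - t_ k @[k --> U] --> `|F x| - t.
    by move=> cF; apply: cvgB => //; apply: cvg_norm; apply: at_x.
  move=> l; split.
  + apply: (cvg0 _ (fun k => mu (w_ k) l * (`|swG P l (x_ k)| - t_ k))) => [k|].
      by have [_ _ _ /(_ l)[]] := FJ k.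
    by apply: cvgM => //; apply: cvg_gap; have [] := cG l.
  + apply: (cvg0 _ (fun k => nu (w_ k) l * (`|swH P l (x_ k)| - t_ k))) => [k|].
      by have [_ _ _ /(_ l)[]] := FJ k.
    by apply: cvgM => //; apply: cvg_gap; have [] := cH l.
  + apply: (cvg0 _ (fun k => mu (w_ k) l * nu (w_ k) l)) => [k|].
      by have [_ _ _ /(_ l)[]] := FJ k.
    exact: cvgM.
Qed.

Lemma fritz_john_M_multipliers x w : fritz_john 0 x w ->
  M_multipliers P x (fun i => lam w i) (fun l => mu w l) (fun l => nu w l) /\
  w None *: grad (obj P) x + constraint_combination P x (fun i => lam w i)
    (fun j => rho w j) (fun l => mu w l) (fun l => nu w l) = 0.
Proof.
move=> [stat _ lamP swP]; split.
- split.
  + by move=> i _; have [] := lamP i.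
  + move=> l; rewrite inE => /andP[G0 _]; have [/eqP + _ _] := swP l.
    by rewrite subr0 mulf_eq0 normr_eq0 (negbTE G0) orbF => /eqP.
  + move=> l; rewrite inE => /andP[_ H0]; have [_ /eqP + _] := swP l.
    by rewrite subr0 mulf_eq0 normr_eq0 (negbTE H0) orbF => /eqP.
  + by move=> l _; have [] := swP l.
- rewrite -[RHS]stat /constraint_combination !addrA; congr (_ + _ + _ + _).
  rewrite big_mkcond; apply: eq_bigr => i _; rewrite inE.
  case: eqP => [//|/eqP gi]; have [_ /eqP] := lamP i.
  by rewrite mulf_eq0 (negbTE gi) orbF => /eqP ->; rewrite scale0r.
Qed.

(** MPSC-NNAMCQ excludes a vanishing weight of the objective; dividing by this
    weight normalises it to 1. *)
Lemma fritz_john_M_stationary x w :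
  feasible P x -> MPSC_NNAMCQ P x -> fritz_john 0 x w ->
  (exists j, w j != 0) -> M_stationary P x.
Proof.
move=> feas cq FJ [j wj]; have [_ w0 lamP _] := FJ.
have wN : w None != 0.
  apply: contra_neq wj => wN0.
  have [MM] := fritz_john_M_multipliers FJ; rewrite wN0 scale0r add0r => comb.
  have [lam0 rho0 mu0 nu0] := cq _ _ _ _ (esym comb) MM.
  (* The constraint qualification speaks of active indices i only; for the
     others complementarity gives the vanishing multiplier. *)
  case: j => [[[i|i]|[l|l]]|] //; have [_ /eqP] := lamP i.
  rewrite mulf_eq0 => /orP[/eqP //|gi]; by apply: lam0; rewrite inE.
have [|MM] := fritz_john_M_multipliers (@fritz_john_scale (w None)^-1 _ _ _ _ FJ).
  by rewrite invr_ge0.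
rewrite mulVf // scale1r => comb.
by split=> //; do 4 eexists; split; [exact: (esym comb)|exact: MM].
Qed.

End FritzJohn.

(** * M-stationarity of the limit *)

Theorem theorem3p6 (R : realType) (n m p q : nat)
    (f : 'rV[R]_n -> R) (g : 'I_m -> 'rV[R]_n -> R) (h : 'I_p -> 'rV[R]_n -> R)
    (G H : 'I_q -> 'rV[R]_n -> R)
    (hf : continuously_differentiable f)
    (hg : forall i, continuously_differentiable (g i))
    (hh : forall j, continuously_differentiable (h j))
    (hG : forall l, continuously_differentiable (G l))
    (hH : forall l, continuously_differentiable (H l))
    (t : nat -> R) (t_gt0 : forall k, 0 < t k)
    (t_cvg : t k @[k --> \oo] --> (0 : R))
    (x : nat -> 'rV[R]_n)
    (x_kkt : forall k, KKT_point (relaxation (MPSC f g h G H) (t k)) (x k))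
    (xbar : 'rV[R]_n) (x_cvg : x k @[k --> \oo] --> xbar) :
  feasible (MPSC f g h G H) xbar /\
  (MPSC_NNAMCQ (MPSC f g h G H) xbar -> M_stationary (MPSC f g h G H) xbar).
Proof.
have cont (F : 'rV[R]_n -> R) : continuously_differentiable F ->
    {for xbar, continuous F} /\ {for xbar, continuous (grad F)}.
  by move=> [dF cF]; split; [exact: differentiable_continuous|exact: cF].
have at_xbar F : continuously_differentiable F ->
    F (x k) @[k --> \oo] --> F xbar.
  by move=> /cont[cF _]; apply: continuous_cvg.
have feas : feasible (MPSC f g h G H) xbar.
  split=> [i|j|l] /=.
  - apply: (closed_cvg _ (@closed_le R 0) _ _ (at_xbar _ (hg i))).
    by apply: nearW => k; have [[/(_ (inl i))]] := x_kkt k.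
  - apply: (cvg_unique (@Rhausdorff R) (at_xbar _ (hh j))).
    rewrite (_ : (fun k => h j (x k)) = fun=> 0); first exact: cvg_cst.
    by apply/funext => k; have [[_ /(_ j)]] := x_kkt k.
  (* min |G| |H| <= t holds along the sequence and is a closed condition. *)
  - have cvg_min : Num.min `|G l (x k)| `|H l (x k)| - t k @[k --> \oo]
        --> Num.min `|G l xbar| `|H l xbar| - 0.
      apply: cvgB => //; apply: (continuous2_cvg).
      + exact: (@min_continuous _ R (_, _)).
      + exact: cvg_norm (at_xbar _ (hG l)).
      + exact: cvg_norm (at_xbar _ (hH l)).
    have : Num.min `|G l xbar| `|H l xbar| - 0 <= 0.
      apply: (closed_cvg _ (@closed_le R 0) _ _ cvg_min).
      apply: nearW => k; rewrite /= subr_le0.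
      apply: (@min_norm_le _ _ _ _ _ (MPSC f g h G H)) => s.
      by have [[/(_ (inr (s, l)))]] := x_kkt k.
    rewrite subr0 ge_min !normr_le0 => /orP[] /eqP ->; by rewrite ?mul0r ?mulr0.
split=> // cq.
have /choice[w wP] : forall k, exists w, w None = 1 /\
    fritz_john (MPSC f g h G H) (t k) (x k) w.
  move=> k; apply: KKT_fritz_john => // l; first by have [] := hG l.
  by have [] := hH l.
have [U [UU leU]] := @ultraFilterLemma nat \oo _.
have [k|c [w' [c0 cw w'0]]] := @cvg_direction_ultra _ _ _ U w UU.
  by exists None; have [-> _] := wP k; rewrite oner_eq0.
apply: (@fritz_john_M_stationary _ _ _ _ _ _ _ w') => //.
apply: (@fritz_john_cvg _ _ _ _ _ _ nat U t x (fun k j => c k * w k j)) => //=.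
- by have [] := cont _ hf.
- by move=> i; apply: cont.
- by move=> j; have [] := cont _ (hh j).
- by move=> l; apply: cont.
- by move=> l; apply: cont.
- exact: cvg_trans (cvg_app _ leU) t_cvg.
- exact: cvg_trans (cvg_app _ leU) x_cvg.
- by move=> k; apply: fritz_john_scale; [exact: ltW|have [] := wP k].
Qed.
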